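(* Let $G$ be a group. (1) If $G$ is Noetherian and Artinian, then $\mathrm{ZR}_l(G)$ is a rooted tree. (2) If $G$ satisfies the ascending and descending chain conditions on normal subgroups, then $\mathrm{ZR}(G)$ is a rooted tree.
   Context: A left-invariant preorder on a group $G$ is a binary relation $\preceq$ on $G$ that is total ($u\preceq v$ or $v\preceq u$ for all $u,v\in G$), transitive, and such that $u\preceq v$ implies $wu\preceq wv$ for all $u,v,w\in G$. It is bi-invariant if in addition $u\preceq v$ implies $uw\preceq vw$. $\mathrm{ZR}_l(G)$ is the set of left-invariant preorders on $G$ and $\mathrm{ZR}(G)$ the set of bi-invariant ones. The trivial preorder $\leq_\emptyset$ is the one with $u\leq_\emptyset v$ for all $u,v\in G$. One writes $\preceq_1\,\boldsymbol{\leq}\,\preceq_2$ if for all $u,v\in G$, $u\preceq_2 v$ implies $u\preceq_1 v$; this is a partial order, and $\boldsymbol{<}$ is the associated strict order. Let $\mathrm{ZR}_*(G)$ be $\mathrm{ZR}_l(G)$ or $\mathrm{ZR}(G)$. Saying that $\mathrm{ZR}_*(G)$ is a rooted tree means that the graph whose vertices are the elements of $\mathrm{ZR}_*(G)$, with an edge between $\preceq_1$ and $\preceq_2$ if and only if $\preceq_1\,\boldsymbol{<}\,\preceq_2$ or $\preceq_2\,\boldsymbol{<}\,\preceq_1$ and no element of $\mathrm{ZR}_*(G)$ lies strictly between them, is a tree (any two vertices are joined by a unique finite path), the root being $\leq_\emptyset$. A group is Noetherian (resp. Artinian) if it satisfies the ascending (resp. descending) chain condition on subgroups. *)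

(* Defs.v *)
From mathcomp Require Import all_boot.
From mathcomp Require Import boolp classical_sets.
Set Implicit Arguments.
Unset Strict Implicit.
Unset Printing Implicit Defensive.

Local Open Scope group_scope.
Local Open Scope classical_set_scope.

(** Groups are arbitrary (possibly infinite): [groupType] carries decidable
    equality and choice, which every group has under the classical axioms of
    [boolp].  Relations are [Prop]-valued, and by the same axioms Leibniz
    equality of relations is pointwise equivalence. *)

Section Preorders.
Variable G : groupType.
Implicit Types (P Q : G -> G -> Prop).

Definition is_left_preorder P : Prop :=
  [/\ forall u v, P u v \/ P v u,
      forall u v w, P u v -> P v w -> P u w
    & forall u v w, P u v -> P (w * u) (w * v)].

Definition is_bi_preorder P : Prop :=
  is_left_preorder P /\ (forall u v w, P u v -> P (u * w) (v * w)).

Definition ZRl : set (G -> G -> Prop) := [set P | is_left_preorder P].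
Definition ZR : set (G -> G -> Prop) := [set P | is_bi_preorder P].

Definition trivial_preorder : G -> G -> Prop := fun _ _ => True.

(** The smaller preorder is the coarser one, i.e. the larger relation. *)
Definition preorder_le P Q : Prop := forall u v, Q u v -> P u v.
Definition preorder_lt P Q : Prop := preorder_le P Q /\ P <> Q.

Definition is_subgroup (H : set G) : Prop := group_closed (mem H).

Definition is_normal_subgroup (H : set G) : Prop :=
  is_subgroup H /\ (forall x g, H x -> H (x ^ g)).

Definition ascending_chain_condition (S : set (set G)) : Prop :=
  forall H : nat -> set G, (forall n, S (H n)) ->
    (forall n, H n `<=` H n.+1) ->
    exists n, forall m, n <= m -> H m = H n.

Definition descending_chain_condition (S : set (set G)) : Prop :=
  forall H : nat -> set G, (forall n, S (H n)) ->
    (forall n, H n.+1 `<=` H n) ->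
    exists n, forall m, n <= m -> H m = H n.

Definition noetherian : Prop := ascending_chain_condition is_subgroup.
Definition artinian : Prop := descending_chain_condition is_subgroup.

Definition between (V : set (G -> G -> Prop)) P Q R : Prop :=
  [/\ V R, preorder_lt P R & preorder_lt R Q].

Definition preorder_edge (V : set (G -> G -> Prop)) P Q : Prop :=
  (preorder_lt P Q /\ ~ exists R, between V P Q R) \/
  (preorder_lt Q P /\ ~ exists R, between V Q P R).

End Preorders.

Section Graphs.
Variables (T : eqType) (V : set T) (E : T -> T -> Prop).

(** [p] lists the vertices of the path after its origin [x]. *)
Definition is_path (x y : T) (p : seq T) : Prop :=
  [/\ forall z, z \in x :: p -> V z,
      path (fun a b => `[< E a b >]) x p,
      uniq (x :: p)
    & last x p = y].

Definition is_tree : Prop :=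
  forall x y, V x -> V y -> exists! p : seq T, is_path x y p.

Definition is_rooted_tree (r : T) : Prop := V r /\ is_tree.

End Graphs.

Arguments ZRl G : clear implicits.
Arguments ZR G : clear implicits.
Arguments trivial_preorder G : clear implicits.
Arguments noetherian G : clear implicits.
Arguments artinian G : clear implicits.

(* Main.v *)
Require Import Defs.
From mathcomp Require Import all_boot.
From mathcomp Require Import boolp classical_sets.

(** In the order on preorders, everything below a fixed [R] is a coarsening of
    [R], and the coarsenings of a left-invariant total preorder form a chain
    ([left_preorder_le_total]).  So the order looks like a forest, and having
    a least element makes it look like a tree; what remains is to know that
    the covering relation sees enough of it.

    The chain conditions provide this.  To [P] one attaches its residue
    [{g | P 1 g and P g 1}], a subgroup, normal when [P] is bi-invariant.
    Coarsening a preorder strictly enlarges its residue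
    ([residue_faithful]), so the ascending condition forbids infinite
    descents [P_0 > P_1 > ...] and the descending one forbids infinite
    ascents.  Hence every nontrivial preorder has a predecessor, and going
    from predecessor to predecessor ends at the trivial preorder: the Hasse
    diagram is connected.

    Paths are unique because each vertex has a single predecessor.  A simple
    path that has gone up once keeps going up, since going down would return to
    the vertex just left; so every simple path descends and then ascends
    ([path_ascends], [path_descends]).  Two simple paths with the same ends
    must therefore begin with the same step. *)

Set Implicit Arguments.
Unset Strict Implicit.
Unset Printing Implicit Defensive.

Local Open Scope group_scope.
Local Open Scope classical_set_scope.

(** * Maximal elements from the absence of infinite chains *)

Lemma extremal_exists (A : Type) (F : set A) (R : A -> A -> Prop) :
  F !=set0 ->
  (forall f : nat -> A, (forall n, F (f n)) -> ~ forall n, R (f n) (f n.+1)) ->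
  exists2 x, F x & forall y, F y -> ~ R x y.
Proof.
move=> [x0 Fx0] no_chain; apply: contrapT => no_extremum.
have step (x : {x | F x}) : exists y : {x | F x}, R (sval x) (sval y).
  case: x => x Fx /=; apply: contrapT => no_step; apply: no_extremum.
  exists x => // y Fy Rxy; apply: no_step.
  by exists (exist _ y Fy).
have [g gR] := choice step.
pose f n := iter n g (exist _ x0 Fx0).
apply: (no_chain (fun n => sval (f n))) => n; first exact: (svalP (f n)).
exact: gR.
Qed.

(** * Hasse diagrams of orders in which lower sets are chains *)

Section HasseTree.
Variables (T : eqType) (V : set T) (le : T -> T -> Prop).

Definition strict x y := le x y /\ x <> y.

Definition covers x y :=
  strict x y /\ ~ exists z, [/\ V z, strict x z & strict z y].

(** For [le] the order on preorders, this unfolds to [preorder_edge]. *)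
Definition hasse x y := covers x y \/ covers y x.

Hypothesis le_refl : forall x, le x x.
Hypothesis le_trans : forall y x z, le x y -> le y z -> le x z.
Hypothesis le_anti : forall x y, le x y -> le y x -> x = y.
Hypothesis le_down_total : forall x y z, V x -> V y -> V z ->
  le x z -> le y z -> le x y \/ le y x.

Lemma cover_below_unique a b x :
  V a -> V b -> V x -> covers a x -> covers b x -> a = b.
Proof.
move=> Va Vb Vx [[ax nax] gap_a] [[bx nbx] gap_b].
apply: contrapT => ab; have ba : b <> a by move/esym.
have [leab|leba] := le_down_total Va Vb Vx ax bx.
  by apply: gap_a; exists b.
by apply: gap_b; exists a.
Qed.

(** The elements below [z] form a chain, and of two distinct covers of [a] in
    it the smaller would lie strictly between [a] and the larger. *)
Lemma cover_above_unique a x y z : V x -> V y -> V z ->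
  covers a x -> covers a y -> le x z -> le y z -> x = y.
Proof.
move=> Vx Vy Vz [ax gap_x] [ay gap_y] xz yz.
apply: contrapT => xy; have yx : y <> x by move/esym.
have [lexy|leyx] := le_down_total Vx Vy Vz xz yz.
  by apply: gap_y; exists x.
by apply: gap_x; exists y.
Qed.

Lemma is_path_cons x y a p : is_path V hasse x y (a :: p) ->
  [/\ V x, V a, hasse x a, x \notin a :: p & is_path V hasse a y p].
Proof.
case=> inV /= /andP[/asboolP xa ap] /andP[xNap u] lst.
split=> //; first by apply: inV; rewrite mem_head.
  by apply: inV; rewrite !inE eqxx orbT.
by split=> // z zap; apply: inV; rewrite inE zap orbT.
Qed.

Lemma is_path_end x y p : is_path V hasse x y p -> V y.
Proof. by case=> inV _ _ <-; apply/inV/mem_last. Qed.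

(** Once it has gone up, a simple path never goes down: the only step down
    leads back to the previous vertex. *)
Lemma path_ascends x y a p :
  is_path V hasse x y (a :: p) -> covers x a -> le a y.
Proof.
elim: p x a => [|b p IHp] x a /is_path_cons[Vx Va _ xNap a_p] xa.
  by case: a_p => _ _ _ /= <-; apply: le_refl.
have /is_path_cons[_ Vb [ab|ba] _ _] := a_p.
  by case: (ab) => -[leab _] _; apply: le_trans leab (IHp _ _ a_p ab).
move: xNap; rewrite (cover_below_unique Vx Vb Va xa ba).
by rewrite !inE eqxx orbT.
Qed.

(** After a descent, a simple path can only turn upwards through a cover other
    than the one it came by.  If it ended above its origin, both covers would
    lie below its end, against [cover_above_unique]. *)
Lemma path_descends x y a p :
  is_path V hasse x y (a :: p) -> covers a x -> ~ le x y.
Proof.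
elim: p x a => [|b p IHp] x a /is_path_cons[Vx Va _ xNap a_p] ax lexy.
  case: a_p => _ _ _ /= ay; case: ax => -[leax nax] _; apply: nax.
  by apply: le_anti; rewrite // ay.
have Vy := is_path_end a_p.
have /is_path_cons[_ Vb [ab|ba] _ _] := a_p; last first.
  by case: ax => -[leax _] _; apply: (IHp _ _ a_p ba) (le_trans leax lexy).
move: xNap; rewrite (cover_above_unique Vx Vb Vy ax ab lexy).
  by rewrite !inE eqxx orbT.
exact: path_ascends a_p ab.
Qed.

Lemma path_nil_unique x y p :
  is_path V hasse x y [::] -> is_path V hasse x y p -> p = [::].
Proof.
case: p => // a p [_ _ _ /= xy] [_ _ /= /andP[xNap _] lst].
by move: xNap; rewrite xy -lst mem_last.
Qed.

(** If one path first goes down and the other up, the end lies above [x] by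
    the second path and not above [x] by the first. *)
Lemma path_unique x y p q :
  is_path V hasse x y p -> is_path V hasse x y q -> p = q.
Proof.
elim: p x q => [|a p IHp] x q xp xq.
  by rewrite (path_nil_unique xp xq).
case: q xq => [|b q] xq; first by rewrite (path_nil_unique xq xp).
have [Vx Va xa _ a_p] := is_path_cons xp.
have [_ Vb xb _ b_q] := is_path_cons xq.
suff ab : a = b by rewrite ab in a_p *; rewrite (IHp _ _ a_p b_q).
have Vy := is_path_end a_p.
have below c r : is_path V hasse x y (c :: r) -> covers x c -> le x y.
  move=> xr xc; apply: le_trans (path_ascends xr xc).
  by case: xc => -[].
case: xa xb => [xa|ax] [xb|bx].
- by apply: (cover_above_unique Va Vb Vy xa xb);
    [apply: path_ascends xp xa | apply: path_ascends xq xb].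
- by case: (path_descends xq bx (below _ _ xp xa)).
- by case: (path_descends xp ax (below _ _ xq xb)).
- exact: cover_below_unique Va Vb Vx ax bx.
Qed.

(** Paths that may revisit vertices, so that they can be concatenated. *)
Definition is_walk x y p :=
  [/\ forall z, z \in x :: p -> V z,
      path (fun a b => `[< hasse a b >]) x p & last x p = y].

Lemma walk_cons x a y p :
  V x -> hasse x a -> is_walk a y p -> is_walk x y (a :: p).
Proof.
move=> Vx xa [inV ap lst]; split=> //=; last by rewrite ap andbT; apply/asboolP.
by move=> z; rewrite inE => /predU1P[->//|]; apply: inV.
Qed.

Lemma walk_rcons x a y p :
  V y -> hasse a y -> is_walk x a p -> is_walk x y (rcons p y).
Proof.
move=> Vy ay [inV xp lst]; split; last by rewrite last_rcons.
  move=> z; rewrite -rcons_cons mem_rcons inE => /predU1P[->//|]; exact: inV.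
by rewrite rcons_path xp lst; apply/asboolP.
Qed.

Lemma walk_cat x y z p q :
  is_walk x y p -> is_walk y z q -> is_walk x z (p ++ q).
Proof.
move=> [inVp xp lstp] [inVq yq lstq]; split.
- move=> t; rewrite -cat_cons mem_cat => /orP[/inVp//|tq].
  by apply: inVq; rewrite inE tq orbT.
- by rewrite cat_path xp lstp.
- by rewrite last_cat lstp.
Qed.

Lemma walk_path x y p : is_walk x y p -> exists q, is_path V hasse x y q.
Proof.
case=> inV xp; case: (shortenP xp) => q xq u qp lst; exists q; split=> // z.
rewrite inE => /predU1P[->|/qp zp]; apply: inV; rewrite inE ?eqxx //.
by rewrite zp orbT.
Qed.

Variable r : T.
Hypothesis Vr : V r.
Hypothesis le_root : forall x, V x -> le r x.
Hypothesis has_minimal : forall F : set T, F `<=` V -> F !=set0 ->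
  exists2 x, F x & forall y, F y -> ~ strict y x.
Hypothesis has_maximal : forall F : set T, F `<=` V -> F !=set0 ->
  exists2 x, F x & forall y, F y -> ~ strict x y.

Lemma cover_below_exists x : V x -> x <> r -> exists2 a, V a & covers a x.
Proof.
move=> Vx xr; pose F := [set a | V a /\ strict a x].
have [] := @has_maximal F; first by move=> a [].
  by exists r; split=> //; split; [apply: le_root | move/esym].
move=> a [Va ax] amax; exists a => //; split=> // -[z [Vz az zx]].
exact: amax az.
Qed.

(** Well-founded induction: a minimal vertex without such walks would get
    them from the vertex it covers. *)
Lemma walks_to_and_from_root x :
  V x -> (exists p, is_walk x r p) /\ (exists p, is_walk r x p).
Proof.
move=> Vx; apply: contrapT => bad_x.
pose F := [set x | V x /\
  ~ ((exists p, is_walk x r p) /\ (exists p, is_walk r x p))].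
have [||y [Vy bad_y] ymin] := @has_minimal F; [by move=> ? []|by exists x|].
apply: bad_y; have [->|yr] := pselect (y = r).
  by split; exists [::]; split=> // z; rewrite inE => /eqP->.
have [a Va ay] := cover_below_exists Vy yr.
have [[p ap] [q aq]] :
    (exists p, is_walk a r p) /\ (exists p, is_walk r a p).
  apply: contrapT => bad_a.
  by have := ymin a (conj Va bad_a); apply; case: ay.
split; [exists (a :: p) | exists (rcons q y)].
  by apply: walk_cons => //; right.
by apply: (walk_rcons _ _ aq) => //; left.
Qed.

(** Two vertices are joined by a walk through the root, from which the loops
    are then removed. *)
Theorem hasse_rooted_tree : is_rooted_tree V hasse r.
Proof.
split=> // x y Vx Vy.
have [[p xr] _] := walks_to_and_from_root Vx.
have [_ [q ry]] := walks_to_and_from_root Vy.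
have [s xs] := walk_path (walk_cat xr ry).
by exists s; split=> // s' xs'; apply: path_unique xs xs'.
Qed.

End HasseTree.

(** * Coarsenings and residues of left-invariant preorders *)

Section Residues.
Variable G : groupType.
Implicit Types (P Q R : G -> G -> Prop) (V : set (G -> G -> Prop)).

Lemma preorder_le_anti P Q : preorder_le P Q -> preorder_le Q P -> P = Q.
Proof.
move=> PQ QP; apply/funext => u; apply/funext => v; apply/propext.
by split; [apply: QP | apply: PQ].
Qed.

Lemma left_preorder1 P u v : is_left_preorder P -> P u v <-> P 1 (u^-1 * v).
Proof.
case=> _ _ Pl; split=> [/(Pl _ _ u^-1)|/(Pl _ _ u)]; first by rewrite mulVg.
by rewrite mulg1 mulVKg.
Qed.

Lemma not_preorder_le P Q : is_left_preorder P -> is_left_preorder Q ->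
  ~ preorder_le P Q -> exists2 a, Q 1 a & ~ P 1 a.
Proof.
move=> Pl Ql nPQ; apply: contrapT => no_a; apply: nPQ => u v.
rewrite (left_preorder1 _ _ Ql) (left_preorder1 _ _ Pl) => Qa.
by apply: contrapT => nPa; apply: no_a; exists (u^-1 * v).
Qed.

(** If both inclusions fail, some [a] is nonnegative for [Q] only and some
    [b] for [P] only; the larger of the two in [R] stays the larger in both
    coarsenings, so it would be nonnegative for both. *)
Lemma left_preorder_le_total P Q R :
  is_left_preorder P -> is_left_preorder Q -> is_left_preorder R ->
  preorder_le P R -> preorder_le Q R -> preorder_le P Q \/ preorder_le Q P.
Proof.
move=> Pl Ql [Rtot _ _] PR QR; apply: contrapT => /not_orP[nPQ nQP].
have [a Qa nPa] := not_preorder_le Pl Ql nPQ.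
have [b Pb nQb] := not_preorder_le Ql Pl nQP.
case: Pl Ql => [_ Ptr _] [_ Qtr _].
case: (Rtot a b) => [/QR ab|/PR ba]; first exact: nQb (Qtr _ _ _ Qa ab).
exact: nPa (Ptr _ _ _ Pb ba).
Qed.

Definition residue P : set G := [set g | P 1 g /\ P g 1].

Lemma residue_subgroup P : is_left_preorder P -> is_subgroup (residue P).
Proof.
case=> Ptot Ptr Pl; split.
  by rewrite inE /=; case: (Ptot 1 1).
move=> x y; rewrite !inE => -[Px xP] [Py yP]; split.
  by apply: Ptr Px _; have := Pl _ _ (x * y^-1) yP; rewrite mulgVK mulg1.
by apply: Ptr xP; have := Pl _ _ (x * y^-1) Py; rewrite mulgVK mulg1.
Qed.

Lemma residue_normal P : is_bi_preorder P -> is_normal_subgroup (residue P).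
Proof.
move=> [Pl Pr]; split; first exact: residue_subgroup.
case: Pl => _ _ Pl x g [Px xP].
split; rewrite -(conj1g g) !conjgE; exact/Pl/Pr.
Qed.

Lemma residue_antitone P Q :
  preorder_le P Q -> residue Q `<=` residue P.
Proof. by move=> PQ g [Qg gQ]; split; apply: PQ. Qed.

(** If [P] coarsens [Q] and [P u v] holds but [Q u v] does not, then [Q v u]
    by totality, so [u^-1 * v] lies in the residue of [P] but not in that of
    [Q]. *)
Lemma residue_faithful P Q : is_left_preorder P -> is_left_preorder Q ->
  preorder_le P Q -> residue P `<=` residue Q -> P = Q.
Proof.
move=> Pl Ql PQ resPQ; apply: preorder_le_anti => // u v Puv.
case: (Ql) => /(_ u v)[//|/PQ Pvu] _ _.
have [] := resPQ (u^-1 * v); last by move=> /(left_preorder1 u v Ql).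
split; first exact: (left_preorder1 u v Pl).1.
by case: Pl => _ _ /(_ _ _ u^-1 Pvu); rewrite mulVg.
Qed.

(** Treats the left-invariant preorders with all subgroups and the
    bi-invariant ones with the normal subgroups at once.  A strictly monotone
    sequence of preorders would give a monotone sequence of residues; where
    that is stationary, [residue_faithful] makes two consecutive preorders
    equal. *)
Lemma preorders_rooted_tree V (S : set (set G)) :
  V `<=` ZRl G -> V (trivial_preorder G) ->
  (forall P, V P -> S (residue P)) ->
  ascending_chain_condition S -> descending_chain_condition S ->
  is_rooted_tree V (preorder_edge V) (trivial_preorder G).
Proof.
move=> Vl Vtriv VS acc dcc.
apply: (@hasse_rooted_tree _ V (@preorder_le G)) => //.
- by move=> P u v.
- by move=> Q P R PQ QR u v /QR/PQ.
- exact: preorder_le_anti.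
- move=> P Q R /Vl Pl /Vl Ql /Vl Rl; exact: left_preorder_le_total.
- move=> F FV F0.
  apply: (@extremal_exists _ F (fun P Q => preorder_lt Q P)) => // f Ff desc.
  have [] := acc (fun n => residue (f n)).
  + by move=> n; apply/VS/FV.
  + by move=> n; apply: residue_antitone; case: (desc n).
  move=> n /(_ n.+1 (leqnSn n)) stable; case: (desc n) => le; apply.
  by apply: residue_faithful le _; [apply/Vl/FV|apply/Vl/FV|rewrite stable].
- move=> F FV F0.
  apply: (@extremal_exists _ F (@preorder_lt G)) => // f Ff asc.
  have [] := dcc (fun n => residue (f n)).
  + by move=> n; apply/VS/FV.
  + by move=> n; apply: residue_antitone; case: (asc n).
  move=> n /(_ n.+1 (leqnSn n)) stable; case: (asc n) => le; apply.
  by apply: residue_faithful le _; [apply/Vl/FV|apply/Vl/FV|rewrite stable].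
Qed.

Lemma trivial_bi_preorder : is_bi_preorder (trivial_preorder G).
Proof. by do !split=> //; left. Qed.

End Residues.

(** * The trees of left-invariant and of bi-invariant preorders *)

Theorem corollary2p38 (G : groupType) :
  (noetherian G -> artinian G ->
     is_rooted_tree (ZRl G) (preorder_edge (ZRl G)) (trivial_preorder G)) /\
  (ascending_chain_condition (@is_normal_subgroup G) ->
   descending_chain_condition (@is_normal_subgroup G) ->
     is_rooted_tree (ZR G) (preorder_edge (ZR G)) (trivial_preorder G)).
Proof.
have [triv_left _] := trivial_bi_preorder G; split=> acc dcc.
  apply: (preorders_rooted_tree _ _ _ acc dcc) => // P; exact: residue_subgroup.
apply: (preorders_rooted_tree _ _ _ acc dcc); first by move=> P [].
  exact: trivial_bi_preorder.
exact: residue_normal.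
Qed.
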